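(* Let $F$ be an infinite field of characteristic different from $2$. The $F$-algebra $M_{a,b}(E)$ has the primeness property for (ordinary) central polynomials.
   Context: $E$ is the Grassmann algebra: the unital associative $F$-algebra generated by $e_1,e_2,\dots$ subject to $e_ie_j=-e_je_i$ for all $i,j\geq 1$. It has basis $\{1\}\cup\{e_{i_1}\cdots e_{i_k}: i_1<\dots<i_k\}$, and $E=E_0\oplus E_1$, where $E_0$ is spanned by $1$ and the basis monomials with $k$ even and $E_1$ by those with $k$ odd. For positive integers $a,b$, $M_{a,b}(E)$ is the subalgebra of $M_{a+b}(E)$ of block matrices $\left(\begin{array}{cc}P&Q\\ S&T\end{array}\right)$ with $P\in M_a(E_0)$, $T\in M_b(E_0)$ and blocks $Q,S$ with entries in $E_1$. For an associative algebra $A$, a polynomial $f(x_1,\dots,x_m)$ in the free associative algebra $F\langle X\rangle$ is an identity for $A$ if $f(a_1,\dots,a_m)=0$ for all $a_i\in A$, and a central polynomial for $A$ if it is not an identity and $f(a_1,\dots,a_m)\in Z(A)$ (the centre of $A$) for all $a_i\in A$. $A$ has the primeness property for central polynomials if, whenever $f(x_1,\dots,x_r)$ and $g(x_{r+1},\dots,x_s)$ are polynomials in distinct variables such that $f\cdot g$ is a central polynomial for $A$, both $f$ and $g$ are central polynomials for $A$. *)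

(* Defs.v *)
From HB Require Import structures.
From mathcomp Require Import all_boot all_order all_algebra.
From mathcomp Require Import finmap.
From mathcomp.multinomials Require Import monalg.

Set Implicit Arguments.
Unset Strict Implicit.
Unset Printing Implicit Defensive.

Import GRing.Theory.
Local Open Scope ring_scope.

(* The basis element e_(i_1) ... e_(i_k), i_1 < ... < i_k, is indexed by the
   finite set {i_1, ..., i_k} of naturals.  Squares of generators are zero,
   which is what e_i e_j = - e_j e_i gives for i = j when 2 is invertible. *)
Definition grassmann (F : fieldType) : Type := {malg F[{fset nat}]}.

HB.instance Definition _ (F : fieldType) :=
  GRing.Lmodule.on (grassmann F).

HB.lock Definition grass_monom (F : fieldType) (c : F) (S : {fset nat}) :
  grassmann F := << c *g S >>.

Definition inversions (S T : {fset nat}) : nat :=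
  (\sum_(i <- S) \sum_(j <- T) (j < i))%N.

(* Sign of the permutation sorting the word e_S e_T. *)
Definition grass_sign (F : fieldType) (S T : {fset nat}) : F :=
  if [disjoint S & T]%fset then (-1) ^+ inversions S T else 0.

HB.lock Definition grass_mul (F : fieldType) (f g : grassmann F) : grassmann F :=
  \sum_(S <- msupp f) \sum_(T <- msupp g)
    grass_monom (grass_sign F S T * (f@_S * g@_T)) (S `|` T)%fset.

Section Grassmann.
Variable F : fieldType.
Local Notation E := (grassmann F).
Implicit Types (S T U : {fset nat}) (f g h : E) (c d : F).
Local Notation mon := (@grass_monom F).
Local Notation grass_mul := (@grass_mul F).
Local Notation grass_sign := (@grass_sign F).

Definition grass_one : E := mon 1 fset0.

Lemma big_fsetU_disj S T (c : nat -> nat) : [disjoint S & T]%fset ->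
  (\sum_(i <- (S `|` T)%fset) c i = \sum_(i <- S) c i + \sum_(i <- T) c i)%N.
Proof.
move=> dST; rewrite (perm_big (S ++ T)) ?big_cat //=.
apply: uniq_perm; rewrite ?cat_uniq ?fset_uniq ?andbT //=.
  apply/hasPn => x xT; apply/negP => xS.
  by have /fdisjointP/(_ x xS)/negP := dST; apply.
by move=> x; rewrite mem_cat in_fsetU.
Qed.

Lemma inversionsUl S T U : [disjoint S & T]%fset ->
  inversions (S `|` T)%fset U = (inversions S U + inversions T U)%N.
Proof. by move=> dST; rewrite /inversions big_fsetU_disj. Qed.

Lemma inversionsUr S T U : [disjoint T & U]%fset ->
  inversions S (T `|` U)%fset = (inversions S T + inversions S U)%N.
Proof.
move=> dTU; rewrite /inversions -big_split /=.
by apply: eq_bigr => i _; rewrite big_fsetU_disj.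
Qed.

Lemma grass_signA S T U :
  grass_sign S T * grass_sign (S `|` T)%fset U =
  grass_sign T U * grass_sign S (T `|` U)%fset.
Proof.
rewrite /grass_sign fdisjointUX fdisjointXU.
case dST: [disjoint S & T]%fset; case dTU: [disjoint T & U]%fset;
  case dSU: [disjoint S & U]%fset; rewrite /= ?mul0r ?mulr0 //.
by rewrite inversionsUl // inversionsUr // -!exprD addnA addnC.
Qed.

Lemma grass_sign0l S : grass_sign fset0 S = 1.
Proof. by rewrite /grass_sign fdisjoint0X /inversions big_seq_fset0. Qed.

Lemma grass_sign0r S : grass_sign S fset0 = 1.
Proof.
rewrite /grass_sign fdisjointX0 /inversions big1 // => i _.
by rewrite big_seq_fset0.
Qed.

Lemma grass_monom0 S : mon 0 S = 0.
Proof. by rewrite grass_monom.unlock monalgU0. Qed.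

Lemma grass_monomD S c d : mon (c + d) S = mon c S + mon d S.
Proof. by rewrite grass_monom.unlock monalgUD. Qed.

Lemma grass_coefD f g S : (f + g)@_S = f@_S + g@_S.
Proof. exact: mcoeffD. Qed.

Lemma grass_coefB f g S : (f - g)@_S = f@_S - g@_S.
Proof. exact: mcoeffB. Qed.

Lemma grass_coefZ c f S : (c *: f)@_S = c * f@_S.
Proof. exact: mcoeffZ. Qed.

Lemma grass_scale_monom c d S : c *: mon d S = mon (c * d) S.
Proof.
rewrite grass_monom.unlock; apply/malgP => T.
by rewrite [LHS]grass_coefZ [in LHS]mcoeffU [RHS]mcoeffU mulrnAr.
Qed.

Lemma grass_ind (P : E -> Prop) :
  P 0 -> (forall c S f, P f -> P (mon c S + f)) -> forall f, P f.
Proof.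
move=> P0 PD f; have -> : f = \sum_(S <- msupp f) mon f@_S S.
  by rewrite grass_monom.unlock; exact: (monalgE f).
elim: (X in \sum_(k <- X) _) => [|S s IH]; rewrite ?big_nil // big_cons.
exact: PD.
Qed.

Lemma grass_mulw (d1 d2 : {fset {fset nat}}) f g :
  (msupp f `<=` d1)%fset -> (msupp g `<=` d2)%fset ->
  grass_mul f g = \sum_(S <- d1) \sum_(T <- d2)
    mon (grass_sign S T * (f@_S * g@_T)) (S `|` T)%fset.
Proof.
move=> le1 le2; rewrite grass_mul.unlock (big_fset_incl _ le1) /=.
  apply/eq_bigr=> S _; apply/big_fset_incl => // T _ /mcoeff_outdom ->.
  by rewrite !mulr0 grass_monom0.
move=> S _ /mcoeff_outdom fS.
by rewrite big1 // => T _; rewrite fS mul0r mulr0 grass_monom0.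
Qed.

Lemma grass_mulDl : left_distributive grass_mul +%R.
Proof.
move=> f1 f2 g; pose d := (msupp f1 `|` msupp f2)%fset.
rewrite !(@grass_mulw d (msupp g)) ?fsubsetUl ?fsubsetUr ?msuppD_le //.
rewrite -big_split /=; apply/eq_bigr => S _.
rewrite -big_split /=; apply/eq_bigr => T _.
by rewrite -grass_monomD grass_coefD mulrDl mulrDr.
Qed.

Lemma grass_mulDr : right_distributive grass_mul +%R.
Proof.
move=> f g1 g2; pose d := (msupp g1 `|` msupp g2)%fset.
rewrite !(@grass_mulw (msupp f) d) ?fsubsetUl ?fsubsetUr ?msuppD_le //.
rewrite -big_split /=; apply/eq_bigr => S _.
rewrite -big_split /=; apply/eq_bigr => T _.
by rewrite -grass_monomD grass_coefD mulrDr mulrDr.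
Qed.

Lemma grass_mul0l : left_zero 0 grass_mul.
Proof. by move=> f; rewrite grass_mul.unlock msupp0 big_seq_fset0. Qed.

Lemma grass_mul0r : right_zero 0 grass_mul.
Proof.
by move=> f; rewrite grass_mul.unlock big1 // => S _; rewrite msupp0 big_seq_fset0.
Qed.

Lemma grass_mulUU (c d : F) S T :
  grass_mul (mon c S) (mon d T) = mon (grass_sign S T * (c * d)) (S `|` T)%fset.
Proof.
rewrite (@grass_mulw [fset S]%fset [fset T]%fset) ?grass_monom.unlock ?msuppU_le //.
by rewrite !big_seq_fset1 !mcoeffUU.
Qed.

Lemma grass_mulUA (c d e : F) S T U :
  grass_mul (mon c S) (grass_mul (mon d T) (mon e U)) =
  grass_mul (grass_mul (mon c S) (mon d T)) (mon e U).
Proof.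
rewrite grass_mulUU grass_mulUU grass_mulUU grass_mulUU fsetUA.
congr (mon _ _).
have -> : grass_sign S (T `|` U)%fset * (c * (grass_sign T U * (d * e))) =
   (grass_sign T U * grass_sign S (T `|` U)%fset) * (c * (d * e)).
  by rewrite -[RHS]mulrA [RHS]mulrCA; congr (_ * _); rewrite mulrCA.
by rewrite -grass_signA -!mulrA mulrCA.
Qed.

Lemma grass_mulA : associative grass_mul.
Proof.
have A3 c d S T h : grass_mul (mon c S) (grass_mul (mon d T) h) =
    grass_mul (grass_mul (mon c S) (mon d T)) h.
  elim/grass_ind: h => [|e U h IH]; first by rewrite !grass_mul0r.
  have := grass_mulUA c d e S T U; move: (mon c S) (mon d T) (mon e U) IH.
  by move=> x y z IH xyz; rewrite !grass_mulDr xyz IH.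
have A2 c S g h : grass_mul (mon c S) (grass_mul g h) =
    grass_mul (grass_mul (mon c S) g) h.
  elim/grass_ind: g => [|d T g IH].
    by rewrite grass_mul0l grass_mul0r grass_mul0l.
  have := A3 c d S T h; move: (mon c S) (mon d T) IH => x y IH xyh.
  by rewrite grass_mulDl !grass_mulDr grass_mulDl xyh IH.
move=> f g h; elim/grass_ind: f => [|c S f IH]; first by rewrite !grass_mul0l.
have := A2 c S g h; move: (mon c S) => x xgh.
by rewrite !grass_mulDl xgh IH.
Qed.

Lemma grass_mul1l : left_id grass_one grass_mul.
Proof.
elim/grass_ind => [|c S f IH]; first by rewrite grass_mul0r.
have : grass_mul grass_one (mon c S) = (mon c S).
  by rewrite grass_mulUU grass_sign0l fset0U !mul1r.
by move: (mon c S) grass_one IH => x y IH yx; rewrite grass_mulDr yx IH.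
Qed.

Lemma grass_mul1r : right_id grass_one grass_mul.
Proof.
elim/grass_ind => [|c S f IH]; first by rewrite grass_mul0l.
have : grass_mul (mon c S) grass_one = (mon c S).
  by rewrite grass_mulUU grass_sign0r fsetU0 mul1r mulr1.
by move: (mon c S) grass_one IH => x y IH yx; rewrite grass_mulDl yx IH.
Qed.

Lemma grass_one_neq0 : grass_one != 0.
Proof. by rewrite /grass_one grass_monom.unlock monalgU_eq0 oner_eq0. Qed.

HB.instance Definition _ := GRing.Zmodule_isNzRing.Build E
  grass_mulA grass_mul1l grass_mul1r grass_mulDl grass_mulDr grass_one_neq0.

Lemma grass_mul_monom c d S T :
  mon c S * mon d T = mon (grass_sign S T * (c * d)) (S `|` T)%fset.
Proof. exact: grass_mulUU. Qed.

Lemma grass_scaleAl c f g : c *: (f * g) = c *: f * g.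
Proof.
elim/grass_ind: f g => [|d S f IH] g; first by rewrite mul0r scaler0 mul0r.
rewrite mulrDl !scalerDr mulrDl IH; congr (_ + _).
elim/grass_ind: g {f IH} => [|e T g IH]; first by rewrite !mulr0 scaler0.
rewrite !mulrDr scalerDr IH; congr (_ + _).
rewrite grass_scale_monom !grass_mul_monom grass_scale_monom.
by rewrite mulrCA -!mulrA.
Qed.

HB.instance Definition _ := GRing.Lmodule_isLalgebra.Build F E grass_scaleAl.

Lemma grass_scaleAr c f g : c *: (f * g) = f * (c *: g).
Proof.
elim/grass_ind: f g => [|d S f IH] g; first by rewrite !mul0r scaler0.
rewrite !mulrDl !scalerDr IH; congr (_ + _).
elim/grass_ind: g {f IH} => [|e T g IH]; first by rewrite !(mulr0, scaler0).
rewrite !(mulrDr, scalerDr) IH; congr (_ + _).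
rewrite grass_scale_monom !grass_mul_monom grass_scale_monom.
by rewrite mulrCA [c * (_ * _)]mulrCA.
Qed.

HB.instance Definition _ := GRing.Lalgebra_isAlgebra.Build F E grass_scaleAr.

Definition grass_gen (i : nat) : E := mon 1 [fset i]%fset.

Lemma grass_gen_anticomm i j :
  grass_gen i * grass_gen j = - (grass_gen j * grass_gen i).
Proof.
rewrite /grass_gen !grass_mul_monom mulr1 !mulr1 fsetUC -scaleN1r.
rewrite grass_scale_monom; congr mon; rewrite mulN1r.
rewrite /grass_sign !fdisjoint1X !inE eq_sym; case: eqVneq => [_|neq_ji] /=.
  by rewrite oppr0.
rewrite /inversions !big_seq_fset1.
by case: ltngtP neq_ji; rewrite ?expr1 ?expr0 ?opprK.
Qed.

Lemma grass_monom_prod S : mon 1 S = \prod_(i <- sort leq S) grass_gen i.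
Proof.
have prodE s : sorted ltn s ->
    \prod_(i <- s) grass_gen i = mon 1 [fset x in s]%fset.
  elim: s => [_|x s IH /= xs].
    by rewrite big_nil (_ : [fset _ in _]%fset = fset0) //; apply/fsetP => y; rewrite !inE.
  have lt_xs : all (ltn x) s by apply: order_path_min xs; exact: ltn_trans.
  rewrite big_cons IH; last exact: path_sorted xs.
  rewrite /grass_gen grass_mul_monom !mulr1; congr mon.
    rewrite /grass_sign fdisjoint1X !inE (_ : x \in s = false) /=; last first.
      by apply/negP => /(allP lt_xs) /=; rewrite ltnn.
    rewrite /inversions big_seq_fset1 big_seq big1 // => y; rewrite !inE.
    by move=> /(allP lt_xs) /= lt_xy; rewrite ltnNge (ltnW lt_xy).
  by apply/fsetP => y; rewrite !inE.
rewrite prodE; first by congr mon; apply/fsetP => x; rewrite !inE mem_sort.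
rewrite ltn_sorted_uniq_leq sort_uniq fset_uniq /=.
by apply: sort_sorted; exact: leq_total.
Qed.

Definition grass_part (p : bool) : {pred E} :=
  fun f => all (fun S => odd #|` S|%fset == p) (msupp f).

Definition grass_even : {pred E} := grass_part false.
Definition grass_odd : {pred E} := grass_part true.

Lemma grass_partP p f :
  reflect (forall S, odd #|` S|%fset != p -> f@_S = 0) (f \in grass_part p).
Proof.
apply: (iffP allP) => [fp S Sp|fp S].
  by apply: mcoeff_outdom; apply: contra Sp => /fp.
by rewrite -mcoeff_neq0; apply: contraNT => /fp ->.
Qed.

Lemma grass_part0 p : 0 \in grass_part p.
Proof. by apply/grass_partP => S _; rewrite mcoeff0. Qed.

Lemma grass_partB p f g :
  f \in grass_part p -> g \in grass_part p -> f - g \in grass_part p.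
Proof.
move=> /grass_partP fp /grass_partP gp; apply/grass_partP => S Sp.
by rewrite grass_coefB fp // gp // subr0.
Qed.

Lemma grass_partD p f g :
  f \in grass_part p -> g \in grass_part p -> f + g \in grass_part p.
Proof.
move=> fp gp; rewrite -[g]opprK -[- g]sub0r.
by do !apply: grass_partB => //; exact: grass_part0.
Qed.

Lemma grass_part_sum p (I : Type) (r : seq I) (P : pred I) (G : I -> E) :
  (forall i, P i -> G i \in grass_part p) ->
  \sum_(i <- r | P i) G i \in grass_part p.
Proof.
move=> Gp; elim/big_ind: _ => //; first exact: grass_part0.
by move=> f g; exact: grass_partD.
Qed.

Lemma grass_partZ p c f : f \in grass_part p -> c *: f \in grass_part p.
Proof.
move=> /grass_partP fp; apply/grass_partP => S Sp.
by rewrite grass_coefZ fp // mulr0.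
Qed.

Lemma grass_part_monom c S : mon c S \in grass_part (odd #|` S|%fset).
Proof.
apply/grass_partP => T; rewrite grass_monom.unlock [X in _ -> X = _]mcoeffU.
by case: (eqVneq S T) => [->|]; rewrite ?eqxx.
Qed.

Lemma grass_part1 : 1 \in grass_even.
Proof. by have := grass_part_monom 1 fset0; rewrite cardfs0. Qed.

Lemma grass_partM p q f g :
  f \in grass_part p -> g \in grass_part q -> f * g \in grass_part (p (+) q).
Proof.
move=> /allP fp /allP gq; 
have -> : f * g = grass_mul f g by [].
rewrite grass_mul.unlock.
rewrite big_seq; apply: grass_part_sum => S /fp /eqP <-.
rewrite big_seq; apply: grass_part_sum => T /gq /eqP <-.
rewrite /grass_sign; case: ifP => [dST|_]; last first.
  by rewrite mul0r grass_monom0 grass_part0.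
have := grass_part_monom ((-1) ^+ inversions S T * (f@_S * g@_T)) (S `|` T)%fset.
by rewrite cardfsU (eqP dST) cardfs0 subn0 oddD.
Qed.

End Grassmann.

(* supermx F a b is M_{a+1,b+1}(E), so that a and b range over nat while both
   block sizes range over the positive integers. *)
Section SuperMatrix.
Variables (F : fieldType) (a b : nat).
Local Notation E := (grassmann F).
Local Notation n := (a.+1 + b.+1)%N.
Implicit Types (M N : 'M[E]_n).

Definition super_pred : {pred 'M[E]_n} := fun M =>
  [&& ulsubmx M \is a mxOver (@grass_even F),
      ursubmx M \is a mxOver (@grass_odd F),
      dlsubmx M \is a mxOver (@grass_odd F)
    & drsubmx M \is a mxOver (@grass_even F)].

Record supermx := SuperMx { supermx_val : 'M[E]_n; _ : supermx_val \in super_pred }.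

HB.instance Definition _ := [isSub for supermx_val].
HB.instance Definition _ := [Choice of supermx by <:].

Lemma super_predP M :
  reflect (forall i j : 'I_n, M i j \in grass_part ((a < i) (+) (a < j))%N)
          (M \in super_pred).
Proof.
have lF (i : 'I_a.+1) : (a < lshift b.+1 i)%N = false.
  by apply/negbTE; rewrite -leqNgt -ltnS; exact: (ltn_ord i).
have rT (i : 'I_b.+1) : (a < rshift a.+1 i)%N by rewrite /= leq_addr.
apply: (iffP and4P) => [[/mxOverP ul /mxOverP ur /mxOverP dl /mxOverP dr] i j|HM].
  rewrite -(splitK i) -(splitK j); case: (split i) => i'; case: (split j) => j' /=.
  - by have := ul i' j'; rewrite !mxE !lF.
  - by have := ur i' j'; rewrite !mxE lF rT.
  - by have := dl i' j'; rewrite !mxE lF rT.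
  - by have := dr i' j'; rewrite !mxE !rT.
split; apply/mxOverP => i j; rewrite !mxE.
- by have := HM (lshift _ i) (lshift _ j); rewrite !lF.
- by have := HM (lshift _ i) (rshift _ j); rewrite lF rT.
- by have := HM (rshift _ i) (lshift _ j); rewrite lF rT.
- by have := HM (rshift _ i) (rshift _ j); rewrite !rT.
Qed.

Lemma super_subring_closed : subring_closed super_pred.
Proof.
split=> [|M N /super_predP HM /super_predP HN|M N /super_predP HM /super_predP HN];
  apply/super_predP => i j; rewrite !mxE.
- case: eqP => [->|_]; last exact: grass_part0.
  by rewrite addbb; exact: grass_part1.
- exact: grass_partB.
- apply: grass_part_sum => k _; have := grass_partM (HM i k) (HN k j).
  by rewrite addbA addbK.
Qed.

HB.instance Definition _ :=
  GRing.SubChoice_isSubNzRing.Build 'M[E]_n super_pred supermx super_subring_closed.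

Lemma super_scale_subproof (c : F) (A : supermx) :
  map_mx ( *:%R c) (val A) \in super_pred.
Proof.
apply/super_predP => i j; rewrite mxE; apply: grass_partZ.
by move: i j; apply/super_predP; exact: valP.
Qed.

Definition super_scale (c : F) (A : supermx) := SuperMx (super_scale_subproof c A).

Lemma superD (A B : supermx) i j : val (A + B) i j = val A i j + val B i j.
Proof. exact: mxE. Qed.

Lemma superM (A B : supermx) i j :
  val (A * B) i j = \sum_k val A i k * val B k j.
Proof. exact: mxE. Qed.

Lemma super_scaleE c A i j : val (super_scale c A) i j = c *: val A i j.
Proof. by rewrite mxE. Qed.

Fact super_scaleA c d A : super_scale c (super_scale d A) = super_scale (c * d) A.
Proof. by apply/val_inj/matrixP => i j; rewrite !super_scaleE scalerA. Qed.

Fact super_scale1 : left_id 1 super_scale.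
Proof.
move=> A; apply/val_inj/matrixP => i j.
by rewrite [LHS]super_scaleE; exact: scale1r.
Qed.

Fact super_scaleDr : right_distributive super_scale +%R.
Proof.
move=> c A B; apply/val_inj/matrixP => i j.
by rewrite super_scaleE 2!superD scalerDr -!super_scaleE.
Qed.

Fact super_scaleDl A : {morph super_scale^~ A : c d / c + d}.
Proof.
move=> c d; apply/val_inj/matrixP => i j.
by rewrite super_scaleE superD scalerDl -!super_scaleE.
Qed.

HB.instance Definition _ := GRing.Zmodule_isLmodule.Build F supermx
  super_scaleA super_scale1 super_scaleDr super_scaleDl.

Lemma superZ c (A : supermx) i j : val (c *: A) i j = c *: val A i j.
Proof. exact: super_scaleE. Qed.

Fact super_scaleAl (c : F) (A B : supermx) : c *: (A * B) = c *: A * B.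
Proof.
apply/val_inj/matrixP => i j; rewrite [LHS]super_scaleE superM [RHS]superM scaler_sumr.
by apply: eq_bigr => k _; rewrite super_scaleE scalerAl.
Qed.

HB.instance Definition _ := GRing.Lmodule_isLalgebra.Build F supermx super_scaleAl.

Fact super_scaleAr (c : F) (A B : supermx) : c *: (A * B) = A * (c *: B).
Proof.
apply/val_inj/matrixP => i j; rewrite [LHS]super_scaleE superM [RHS]superM scaler_sumr.
by apply: eq_bigr => k _; rewrite super_scaleE scalerAr.
Qed.

HB.instance Definition _ := GRing.Lalgebra_isAlgebra.Build F supermx super_scaleAr.

End SuperMatrix.

(* The unital free algebra on x_0, x_1, ...; constant terms are allowed. *)
Notation free_algebra F := {malg F[{fmonom nat}]}.

Section Central.
Variables (F : fieldType) (A : algType F).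
Implicit Types (f g : free_algebra F) (v : nat -> A).

Definition free_eval v f : A :=
  mmap (GRing.in_alg A) (fun w : {fmonom nat} => \prod_(i <- w) v i) f.

Definition poly_identity f : Prop := forall v, free_eval v f = 0.

Definition central_polynomial f : Prop :=
  ~ poly_identity f /\ forall v (z : A), GRing.comm (free_eval v f) z.

(* Only the variables x_i with m <= i < n occur in f; variables are numbered
   from 0, so f(x_1, ..., x_r) is in_variables 0 r f. *)
Definition in_variables (m n : nat) f : Prop :=
  forall w, w \in msupp f -> all (fun i => m <= i < n)%N w.

Definition primeness_central : Prop :=
  forall (r s : nat) f g, (r <= s)%N ->
    in_variables 0 r f -> in_variables r s g ->
    central_polynomial (f * g) ->
    central_polynomial f /\ central_polynomial g.

End Central.

(* Main.v *)
(* The values of f and of g are stable under all endomorphisms of A = M_{a,b}(E):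
   conjugation by diagonal sign matrices and by 1 + y e_pq, and the shift
   e_i |-> e_(N+i), which makes factors involve disjoint generators, so that a
   product x * shift z vanishes only if x or z does.  All f(u) g(v) are central.

   If some w = g(v) had an entry w_ij <> 0 with i <> j, comparing w with its sign
   conjugate at i in the vanishing (k, j) entry of f(u) w gives
   2 f(u)_ki w_ij = 0, hence f(u)_ki = 0 for all u and all k <> j; conjugating u
   then kills row i of f(u), and finally f(u).  So the values of g are diagonal,
   and stability under conjugation makes their diagonal entries equal: g is
   central.  Then [f(u), z] g(v) = 0 with g(v) scalar and shiftable, so f is
   central as well. *)
From HB Require Import structures.
Require Import Defs.
From mathcomp Require Import all_boot all_order all_algebra.
From mathcomp Require Import finmap.
From mathcomp.multinomials Require Import monalg.

Set Implicit Arguments.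
Unset Strict Implicit.
Unset Printing Implicit Defensive.

Import GRing.Theory.
Local Open Scope ring_scope.

(** * Supercommutativity, generator shifts and regular elements of the Grassmann algebra *)

Section GrassmannTheory.
Variable F : fieldType.
Local Notation E := (grassmann F).
Implicit Types (S T : {fset nat}) (f g : E).
Local Notation mon := (@grass_monom F).
Local Notation grass_sign := (@grass_sign F).

Lemma grass_coef_monom (c : F) S T : (mon c S)@_T = c *+ (S == T).
Proof. by rewrite grass_monom.unlock; exact: mcoeffU. Qed.

Lemma grassE f : f = \sum_(S <- msupp f) mon f@_S S.
Proof. by rewrite grass_monom.unlock; exact: monalgE. Qed.

Lemma grass_coef_sum (I : Type) (r : seq I) (P : pred I) (G : I -> E) S :
  (\sum_(i <- r | P i) G i)@_S = \sum_(i <- r | P i) (G i)@_S.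
Proof. exact: (raddf_sum (mcoeff S)). Qed.

(** Disjointness makes each pair from [S] and [T] an inversion in exactly one of the two orders. *)
Lemma inversionsC S T : [disjoint S & T]%fset ->
  (inversions S T + inversions T S = #|` S|%fset * #|` T|%fset)%N.
Proof.
move=> dST; rewrite /inversions [X in (_ + X)%N]exchange_big -big_split /=.
rewrite big_seq (eq_bigr (fun=> #|` T|%fset)); last first.
  move=> i iS; rewrite -big_split /= big_seq (eq_bigr (fun=> 1%N)) => [|j jT].
    by rewrite -big_seq sum1_size.
  case: ltngtP => // eq_ij; have /fdisjointP/(_ i iS) := dST.
  by rewrite -eq_ij jT.
by rewrite -big_seq big_const_seq count_predT iter_addn_0 mulnC.
Qed.

Lemma grass_signC S T :
  grass_sign S T = (-1) ^+ (odd #|` S|%fset && odd #|` T|%fset) * grass_sign T S.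
Proof.
rewrite /grass_sign [[disjoint T & S]%fset]fdisjoint_sym.
case: ifP => dST; last by rewrite mulr0.
rewrite -oddM -(inversionsC dST) signr_odd exprD -mulrA -expr2 -exprM mulnC.
by rewrite exprM sqrrN !expr1n mulr1.
Qed.

Lemma grass_supercomm p q f g : f \in grass_part p -> g \in grass_part q ->
  f * g = (-1) ^+ (p && q) *: (g * f).
Proof.
move=> /allP fp /allP gq; rewrite [f]grassE [g]grassE !mulr_suml scaler_sumr.
under eq_bigr => S _ do rewrite mulr_sumr.
rewrite exchange_big /= [LHS]big_seq [RHS]big_seq; apply: eq_bigr => T /gq /eqP <-.
rewrite mulr_sumr scaler_sumr [LHS]big_seq [RHS]big_seq.
apply: eq_bigr => S /fp /eqP <-.
rewrite !grass_mul_monom grass_scale_monom fsetUC grass_signC.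
by rewrite -mulrA [f@__ * _]mulrC.
Qed.

(** Only [f] is homogeneous, so [g] is expanded into monomials, each of a definite parity. *)
Lemma grass_evenC f g : f \in @grass_even F -> f * g = g * f.
Proof.
move=> f0; rewrite [g]grassE mulr_sumr mulr_suml; apply: eq_bigr => S _.
by rewrite (grass_supercomm f0 (grass_part_monom _ S)) /= scale1r.
Qed.

Definition fset_shift N S : {fset nat} := [fset (N + i)%N | i in S]%fset.

Lemma mem_fset_shift N S i : (N + i \in fset_shift N S)%N = (i \in S).
Proof. by rewrite mem_imfset //= => x y /addnI. Qed.

Lemma fset_shift_inj N : injective (fset_shift N).
Proof.
by move=> S T eqST; apply/fsetP => i; rewrite -(mem_fset_shift N) eqST mem_fset_shift.
Qed.

Lemma card_fset_shift N S : #|` fset_shift N S|%fset = #|` S|%fset.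
Proof. by rewrite card_imfset //= => x y /addnI. Qed.

Lemma fset_shift0 N : fset_shift N fset0 = fset0.
Proof. by apply/eqP; rewrite -cardfs_eq0 card_fset_shift cardfs0. Qed.

Lemma fset_shiftU N S T :
  fset_shift N (S `|` T)%fset = (fset_shift N S `|` fset_shift N T)%fset.
Proof. by rewrite /fset_shift imfsetU. Qed.

Lemma inversions_shift N S T :
  inversions (fset_shift N S) (fset_shift N T) = inversions S T.
Proof.
have inj : {in S &, injective (addn N)} by move=> x y _ _ /addnI.
rewrite /inversions big_imfset //=; apply: eq_bigr => i _.
rewrite big_imfset /=; last by move=> x y _ _ /addnI.
by apply: eq_bigr => j _; rewrite ltn_add2l.
Qed.

Lemma fdisjoint_shift N S T :
  [disjoint fset_shift N S & fset_shift N T]%fset = [disjoint S & T]%fset.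
Proof.
apply/fdisjointP/fdisjointP => dST i.
  by move=> iS; rewrite -(mem_fset_shift N) dST ?mem_fset_shift.
by move=> /imfsetP [j /= jS ->]; rewrite mem_fset_shift dST.
Qed.

(** Translation by [N] is injective and increasing, so it keeps disjointness and inversions; this
    makes the shift multiplicative. *)
Lemma grass_sign_shift N S T :
  grass_sign (fset_shift N S) (fset_shift N T) = grass_sign S T.
Proof. by rewrite /grass_sign fdisjoint_shift inversions_shift. Qed.

Definition grass_shift N f : E := \sum_(S <- msupp f) mon f@_S (fset_shift N S).

Lemma grass_shiftw N f (d : {fset {fset nat}}) : (msupp f `<=` d)%fset ->
  grass_shift N f = \sum_(S <- d) mon f@_S (fset_shift N S).
Proof.
move=> le; rewrite /grass_shift (big_fset_incl _ le) // => S _ /mcoeff_outdom ->.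
exact: grass_monom0.
Qed.

Lemma grass_shift_is_zmod_morphism N : zmod_morphism (grass_shift N).
Proof.
move=> f g; pose d := (msupp f `|` msupp g)%fset.
rewrite !(@grass_shiftw N _ d) ?fsubsetUl ?fsubsetUr ?msuppB_le //.
rewrite -sumrB; apply: eq_bigr => S _; rewrite grass_coefB grass_monomD.
by rewrite -scaleN1r grass_scale_monom mulN1r.
Qed.

HB.instance Definition _ N :=
  GRing.isZmodMorphism.Build E E (grass_shift N) (grass_shift_is_zmod_morphism N).

Lemma grass_shift_monom N c S : grass_shift N (mon c S) = mon c (fset_shift N S).
Proof.
rewrite (@grass_shiftw N _ [fset S]%fset) ?grass_monom.unlock ?msuppU_le //.
by rewrite big_seq_fset1 mcoeffUU.
Qed.

Lemma grass_shift_is_scalable N : scalable (grass_shift N).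
Proof.
move=> c f; elim/grass_ind: f => [|d S f IH]; first by rewrite !(raddf0, scaler0).
rewrite scalerDr !raddfD /= IH grass_scale_monom !grass_shift_monom.
by rewrite grass_scale_monom.
Qed.

HB.instance Definition _ N :=
  GRing.isScalable.Build F E E *:%R (grass_shift N) (grass_shift_is_scalable N).

Lemma grass_shift_is_monoid_morphism N : monoid_morphism (grass_shift N).
Proof.
split=> [|f g]; first by rewrite [LHS]grass_shift_monom fset_shift0.
elim/grass_ind: f g => [|c S f IH] g; first by rewrite !(raddf0, mul0r).
rewrite mulrDl !raddfD /= mulrDl IH; congr (_ + _).
elim/grass_ind: g {f IH} => [|d T g IH]; first by rewrite !(raddf0, mulr0).
rewrite mulrDr !raddfD /= mulrDr IH; congr (_ + _).
by rewrite grass_mul_monom !grass_shift_monom grass_mul_monom grass_sign_shift fset_shiftU.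
Qed.

HB.instance Definition _ N :=
  GRing.isMonoidMorphism.Build E E (grass_shift N) (grass_shift_is_monoid_morphism N).

Lemma grass_shift_part N p f : f \in grass_part p -> grass_shift N f \in grass_part p.
Proof.
move=> /allP fp; rewrite /grass_shift big_seq; apply: grass_part_sum => S /fp /eqP <-.
by rewrite -(card_fset_shift N S) grass_part_monom.
Qed.

(* For N beyond every generator in f, the supports of f and of the shifted g
   use disjoint sets of generators and no inversion occurs in their product. *)
Lemma grass_shift_regular f g : g != 0 ->
  exists N, f * grass_shift N g = 0 -> f = 0.
Proof.
move=> g0; have [T0 gT0] : exists T, g@_T != 0.
  have [g_0|[T T_g]] := fset_0Vmem (msupp g); last by exists T; rewrite mcoeff_neq0.
  by case/eqP: g0; rewrite [g]grassE g_0 big_seq_fset0.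
pose N := (\max_(S <- msupp f) \max_(i <- S) i)%N.+1; exists N => fg0.
have ltN S : S \in msupp f -> forall i, i \in S -> (i < N)%N.
  move=> Sf i iS; rewrite ltnS.
  by apply: (bigmax_sup_seq S Sf) => //; apply: (bigmax_sup_seq i iS).
have geN T i : i \in fset_shift N T -> (i < N)%N = false.
  by move=> /imfsetP [j _ ->]; rewrite ltnNge leq_addr.
(* Cutting at [N] recovers [S] and [T] from the union of [S] with the shifted [T]. *)
have low S T i : S \in msupp f ->
    (i \in S) = (i \in S `|` fset_shift N T)%fset && (i < N)%N.
  move=> Sf; rewrite in_fsetU; apply/idP/idP => [iS|/andP[/orP[//|/geN ->//]]].
  by rewrite iS (ltN S).
have high S T i : S \in msupp f ->
    (i \in fset_shift N T) = (i \in S `|` fset_shift N T)%fset && ~~ (i < N)%N.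
  move=> Sf; rewrite in_fsetU; apply/idP/idP => [iT|/andP[/orP[/(ltN S Sf) ->//|//]]].
  by rewrite iT orbT (geN T).
have [f_0|[S0 S0f]] := fset_0Vmem (msupp f); first by rewrite [f]grassE f_0 big_seq_fset0.
suff: f@_S0 = 0 by move/eqP; rewrite mcoeff_eq0 S0f.
(* By this uniqueness only the pair [S0], [T0] contributes to the coefficient, which is a sign times
   [f@_S0 * g@_T0]. *)
have := congr1 (mcoeff (S0 `|` fset_shift N T0)%fset) fg0.
rewrite mcoeff0 [f]grassE /grass_shift mulr_suml grass_coef_sum.
rewrite (big_fsetD1 S0) //= mulr_sumr grass_coef_sum (big_fsetD1 T0) -?mcoeff_neq0 //=.
rewrite grass_mul_monom grass_coef_monom eqxx mulr1n.
rewrite big1_fset => [|T]; last first.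
  rewrite in_fsetD1 => /andP[neT _] _; rewrite grass_mul_monom grass_coef_monom.
  case: eqP => // eqST; case/eqP: neT; apply: (@fset_shift_inj N); apply/fsetP => i.
  by rewrite (high S0 T) // eqST -(high S0 T0).
rewrite big1_fset => [|S]; last first.
  rewrite in_fsetD1 => /andP[neS Sf] _; rewrite mulr_sumr grass_coef_sum big1 // => T _.
  rewrite grass_mul_monom grass_coef_monom.
  case: eqP => // eqST; case/eqP: neS; apply/fsetP => i.
  by rewrite (low S T) // eqST -(low S0 T0).
rewrite !addr0 -grassE => /eqP H; apply/eqP; move: H; rewrite !mulf_eq0 (negbTE gT0) orbF.
rewrite /grass_sign ifT ?signr_eq0 //.
by apply/fdisjointP => i /(ltN S0 S0f) iN; apply/negP => /geN; rewrite iN.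
Qed.

(** The witness is [1] for even parity and a generator [e_N], with [N] chosen from [f], for odd
    parity. Odd elements have square zero, so no single odd [y] serves every [f]. *)
Lemma grass_part_regular p f :
  exists2 y : E, y \in grass_part p & (f * y = 0 -> f = 0).
Proof.
pose S := if p then [fset 0%N]%fset else fset0.
have mS : mon 1 S \in grass_part p.
  by have := grass_part_monom (1 : F) S; rewrite /S; case: p {S}; rewrite ?cardfs1 ?cardfs0.
have [|N fN] := @grass_shift_regular f (mon 1 S).
  apply/eqP => /(congr1 (mcoeff S)); rewrite grass_coef_monom eqxx mcoeff0.
  by apply/eqP; exact: oner_neq0.
by exists (grass_shift N (mon 1 S)) => //; exact: grass_shift_part.
Qed.

End GrassmannTheory.

(** * Evaluation of free polynomials and its compatibility with endomorphisms *)

Section FreeEval.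
Variables (F : fieldType) (A : algType F).
Implicit Types (f g : free_algebra F) (v : nat -> A).

Definition word_eval v (w : {fmonom nat}) : A := \prod_(i <- w) v i.

Lemma word_eval_is_mmorphism v : mmorphism (word_eval v).
Proof.
split; first by move=> w1 w2; rewrite /word_eval fmM big_cat.
by rewrite /word_eval fm1 big_nil.
Qed.

HB.instance Definition _ v :=
  isMultiplicative.Build {fmonom nat} A (word_eval v) (word_eval_is_mmorphism v).

Lemma free_evalM v f g : free_eval v (f * g) = free_eval v f * free_eval v g.
Proof.
have [|M _] := @commr_mmap_is_multiplicative {fmonom nat} F A (GRing.in_alg A) (word_eval v).
  by move=> h w w'; rewrite /GRing.comm mulr_algl mulr_algr.
exact: M.
Qed.

Lemma free_evalE v f : free_eval v f = \sum_(w <- msupp f) f@_w *: word_eval v w.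
Proof. by apply: eq_bigr => w _; rewrite mulr_algl. Qed.

(** An endomorphism fixes the scalar coefficients and moves only the values of the variables. Every
    symmetry of the set of values used below comes from here. *)
Lemma free_eval_endo (phi : {lrmorphism A -> A}) v f :
  phi (free_eval v f) = free_eval (phi \o v) f.
Proof.
rewrite !free_evalE raddf_sum; apply: eq_bigr => w _.
by rewrite /= linearZ /word_eval /= rmorph_prod.
Qed.

Lemma eq_in_free_eval m n f v w : in_variables m n f ->
  (forall i, (m <= i < n)%N -> v i = w i) -> free_eval v f = free_eval w f.
Proof.
move=> fmn vw; rewrite !free_evalE [LHS]big_seq [RHS]big_seq.
apply: eq_bigr => u /fmn /allP u_mn; congr (_ *: _).
by apply: eq_big_seq => i /u_mn /vw.
Qed.

(** The inverse relations are arguments so that morphism structures can be attached to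
    [inner hg gh]. *)
Definition inner (g h : A) of h * g = 1 & g * h = 1 := fun x : A => g * x * h.

Section Inner.
Variables (g h : A) (hg : h * g = 1) (gh : g * h = 1).

Lemma inner_is_zmod_morphism : zmod_morphism (inner hg gh).
Proof. by move=> x y; rewrite /inner mulrBr mulrBl. Qed.

HB.instance Definition _ :=
  GRing.isZmodMorphism.Build A A (inner hg gh) inner_is_zmod_morphism.

Lemma inner_is_monoid_morphism : monoid_morphism (inner hg gh).
Proof.
split=> [|x y]; rewrite /inner ?mulr1 //.
by rewrite !mulrA -[g * x * h * g]mulrA hg mulr1.
Qed.

HB.instance Definition _ :=
  GRing.isMonoidMorphism.Build A A (inner hg gh) inner_is_monoid_morphism.

Lemma inner_is_scalable : scalable (inner hg gh).
Proof. by move=> c x; rewrite /inner -scalerAr -scalerAl. Qed.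

HB.instance Definition _ :=
  GRing.isScalable.Build F A A *:%R (inner hg gh) inner_is_scalable.

End Inner.

Lemma free_eval_square0 v f (N : A) : N * N = 0 ->
  exists w, free_eval w f = (1 + N) * free_eval v f * (1 - N).
Proof.
move=> N0.
have hg : (1 - N) * (1 + N) = 1 by rewrite mulrDr mulr1 mulrBl mul1r N0 subr0 subrK.
have gh : (1 + N) * (1 - N) = 1 by rewrite mulrBr mulr1 mulrDl mul1r N0 addr0 addrK.
by exists (inner hg gh \o v); rewrite -free_eval_endo.
Qed.

End FreeEval.

(* Locked: unification otherwise unfolds the subtype structure of supermx. *)
HB.lock Definition entry (F : fieldType) (a b : nat) (A : supermx F a b)
  (i j : 'I_(a.+1 + b.+1)) : grassmann F := val A i j.

(** * Entries, centre, conjugations and twisted shifts in M_{a+1,b+1}(E) *)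

Section SuperMatrixTheory.
Variables (F : fieldType) (a b : nat).
Local Notation E := (grassmann F).
Local Notation n := (a.+1 + b.+1)%N.
Local Notation M := (supermx F a b).
Local Notation parity i j := ((a < nat_of_ord i) (+) (a < nat_of_ord j))%N.
Implicit Types (i j k l p q : 'I_n) (y : E) (A B c : M) (s : pred 'I_n).

Lemma entry_part A i j : entry A i j \in grass_part (parity i j).
Proof. by rewrite entry.unlock; move: i j; apply/super_predP; exact: valP. Qed.

Lemma entry_even A i : entry A i i \in @grass_even F.
Proof. by have := entry_part A i i; rewrite addbb. Qed.

Lemma eq_entry A B : (forall i j, entry A i j = entry B i j) <-> A = B.
Proof. by rewrite entry.unlock; split=> [AB|->//]; apply/val_inj/matrixP. Qed.

Lemma entry1 i j : entry (1 : M) i j = (i == j)%:R.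
Proof. by rewrite entry.unlock; exact: mxE. Qed.

Lemma entry0 i j : entry (0 : M) i j = 0.
Proof. by rewrite entry.unlock; exact: mxE. Qed.

Lemma entryN A i j : entry (- A) i j = - entry A i j.
Proof. by rewrite entry.unlock; exact: mxE. Qed.

Lemma entryD A B i j : entry (A + B) i j = entry A i j + entry B i j.
Proof. by rewrite entry.unlock; exact: superD. Qed.

Lemma entryM A B i j : entry (A * B) i j = \sum_k entry A i k * entry B k j.
Proof. by rewrite entry.unlock; exact: superM. Qed.

Lemma entryZ (d : F) A i j : entry (d *: A) i j = d *: entry A i j.
Proof. by rewrite entry.unlock; exact: superZ. Qed.

Lemma super_of_entries (m : 'I_n -> 'I_n -> E) :
  (forall i j, m i j \in grass_part (parity i j)) ->
  {A : M | forall i j, entry A i j = m i j}.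
Proof.
move=> mp; have mS : \matrix_(i, j) m i j \in super_pred (F := F) (a := a) (b := b).
  by apply/super_predP => i j; rewrite mxE.
by exists (SuperMx mS) => i j; rewrite entry.unlock mxE.
Qed.

Lemma super_delta_subproof p q y : y \in grass_part (parity p q) ->
  forall i j, (if (i == p) && (j == q) then y else 0) \in grass_part (parity i j).
Proof.
by move=> yp i j; case: ifP => [/andP[/eqP-> /eqP->]|_] //; exact: grass_part0.
Qed.

(** The matrix [y e_pq]. *)
Definition super_delta p q y (yp : y \in grass_part (parity p q)) : M :=
  sval (super_of_entries (super_delta_subproof yp)).

Lemma super_deltaE p q y (yp : y \in grass_part (parity p q)) i j :
  entry (super_delta yp) i j = if (i == p) && (j == q) then y else 0.
Proof. exact: svalP (super_of_entries _) i j. Qed.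

Lemma entryM_delta A p q y (yp : y \in grass_part (parity p q)) i j :
  entry (A * super_delta yp) i j = if j == q then entry A i p * y else 0.
Proof.
rewrite entryM (bigD1 p) //= super_deltaE eqxx big1 => [|k /negbTE kp].
  by rewrite addr0; case: eqP; rewrite ?mulr0.
by rewrite super_deltaE kp mulr0.
Qed.

Lemma entry_deltaM A p q y (yp : y \in grass_part (parity p q)) i j :
  entry (super_delta yp * A) i j = if i == p then y * entry A q j else 0.
Proof.
rewrite entryM (bigD1 q) //= super_deltaE eqxx big1 => [|k /negbTE kp].
  by rewrite addr0 andbT; case: eqP; rewrite ?mul0r.
by rewrite super_deltaE kp andbF mul0r.
Qed.

(** Commutation with [e_jj] kills the off-diagonal entries. Commutation with [y e_ij], where [y] is
    regular for the difference of two diagonal entries, makes them equal. Conversely, the common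
    diagonal entry is even, hence central in [E]. *)
Lemma super_centralP c :
  (forall z, GRing.comm c z) <->
  (forall i j, i != j -> entry c i j = 0) /\ (forall i j, entry c i i = entry c j j).
Proof.
split=> [cC|[c0 cD] z]; last first.
  apply/eq_entry => i j; rewrite !entryM (bigD1 i) //= big1 => [|k ki].
    rewrite [RHS](bigD1 j) //= [X in _ = _ + X]big1 => [|k kj].
      by rewrite !addr0 (cD i j) grass_evenC // entry_even.
    by rewrite c0 // mulr0.
  by rewrite c0 1?eq_sym // mul0r.
split=> i j => [ij|].
  have y1 : 1 \in @grass_part F (parity j j) by rewrite addbb grass_part1.
  have /eq_entry/(_ i j) := cC (super_delta y1).
  by rewrite entryM_delta entry_deltaM eqxx (negbTE ij) mulr1.
have [y yp yreg] := grass_part_regular (parity i j) (entry c i i - entry c j j).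
have /eq_entry/(_ i j) := cC (super_delta yp).
rewrite entryM_delta entry_deltaM !eqxx -(grass_evenC y (entry_even c j)) => cy.
by apply/eqP; rewrite -subr_eq0; apply/eqP/yreg; rewrite mulrBl cy subrr.
Qed.

(** The left factor adds [y] times row [q] to row [p]; the right factor then subtracts column [p]
    times [y] from column [q]. *)
Lemma super_conj A p q y (yp : y \in grass_part (parity p q)) i j :
  entry ((1 + super_delta yp) * A * (1 - super_delta yp)) i j =
  entry A i j + (if i == p then y * entry A q j else 0)
  - (if j == q then (entry A i p + if i == p then y * entry A q p else 0) * y else 0).
Proof.
rewrite mulrBr mulr1 entryD entryN entryM_delta !mulrDl !mul1r !entryD.
by rewrite !entry_deltaM mulrDl.
Qed.

Lemma super_delta_square0 p q y (yp : y \in grass_part (parity p q)) :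
  p != q -> super_delta yp * super_delta yp = 0.
Proof.
move=> pq; apply/eq_entry => i j; rewrite entry_deltaM entry0 super_deltaE.
by rewrite [q == p]eq_sym (negbTE pq) mulr0 if_same.
Qed.

(* The generator shift composed with the conjugation by a diagonal sign matrix. *)
Section Twist.
Variables (N : nat) (s : pred 'I_n).

Lemma super_twist_exists : {phi : M -> M | forall A i j,
  entry (phi A) i j = (-1) ^+ (s i (+) s j) *: grass_shift N (entry A i j)}.
Proof.
have tw A i j :
    (-1) ^+ (s i (+) s j) *: grass_shift N (entry A i j) \in grass_part (parity i j).
  exact/grass_partZ/grass_shift_part/entry_part.
by exists (fun A => sval (super_of_entries (tw A))) => A; exact: svalP (super_of_entries _).
Qed.

Definition super_twist : M -> M := sval super_twist_exists.

Lemma super_twistE A i j :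
  entry (super_twist A) i j = (-1) ^+ (s i (+) s j) *: grass_shift N (entry A i j).
Proof. exact: (svalP super_twist_exists). Qed.

Lemma super_twist_is_zmod_morphism : zmod_morphism super_twist.
Proof.
move=> A B; apply/eq_entry => i j.
by rewrite entryD entryN !super_twistE entryD entryN raddfB scalerBr.
Qed.

HB.instance Definition _ :=
  GRing.isZmodMorphism.Build M M super_twist super_twist_is_zmod_morphism.

Lemma super_twist_is_monoid_morphism : monoid_morphism super_twist.
Proof.
split=> [|A B]; apply/eq_entry => i j; rewrite [LHS]super_twistE.
  by rewrite !entry1 rmorph_nat; case: eqP => [->|]; rewrite ?scaler0 // addbb scale1r.
rewrite [in LHS]entryM [RHS]entryM rmorph_sum scaler_sumr; apply: eq_bigr => k _.
rewrite !super_twistE rmorphM -scalerAl -scalerAr.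
(* The sign splits over the intermediate index [k]. *)
have -> : s i (+) s j = (s i (+) s k) (+) (s k (+) s j) by rewrite addbA addbK.
by rewrite signr_addb -scalerA.
Qed.

HB.instance Definition _ :=
  GRing.isMonoidMorphism.Build M M super_twist super_twist_is_monoid_morphism.

Lemma super_twist_is_scalable : scalable super_twist.
Proof.
move=> c A; apply/eq_entry => i j; rewrite [LHS]super_twistE [in LHS]entryZ linearZ.
by rewrite scalerA mulrC -scalerA -super_twistE entryZ.
Qed.

HB.instance Definition _ :=
  GRing.isScalable.Build F M M *:%R super_twist super_twist_is_scalable.

End Twist.

(** * Values of two polynomials whose product is central *)

Section CentralProduct.
Variables f g : free_algebra F.
Hypothesis two_neq0 : 2%:R != 0 :> F.
(** The assignments [u] and [v] are independent: one factor can be transformed while the other stays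
    fixed. *)
Hypothesis fg_central :
  forall (u v : nat -> M) z, GRing.comm (free_eval u f * free_eval v g) z.

(* The values of a polynomial are stable under conjugation by 1 + y e_pq, whose
   inverse is 1 - y e_pq when p <> q. *)
Lemma conj_value (h : free_algebra F) (u : nat -> M) p q y
    (yp : y \in grass_part (parity p q)) :
  p != q -> exists v : nat -> M, forall i j, entry (free_eval v h) i j =
    entry (free_eval u h) i j + (if i == p then y * entry (free_eval u h) q j else 0)
    - (if j == q then
         (entry (free_eval u h) i p + if i == p then y * entry (free_eval u h) q p else 0) * y
       else 0).
Proof.
move=> /(super_delta_square0 yp) /(free_eval_square0 u h) [v Ev].
by exists v => i j; rewrite Ev super_conj.
Qed.

(** Conjugation by [1 + y e_pk] brings [y] times row [k] into row [p], which vanishes for every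
    value. *)
Lemma row_zero_identity (h : free_algebra F) p :
  (forall (u : nat -> M) k, entry (free_eval u h) p k = 0) ->
  poly_identity M h.
Proof.
move=> hp u; apply/eq_entry => k l; rewrite entry0.
have [->|pk] := eqVneq k p; first exact: hp.
have [y yp yreg] := grass_part_regular (parity p k) (entry (free_eval u h) k l).
rewrite eq_sym in pk; have [v Ev] := conj_value h u yp pk.
apply: yreg; have yu0 j : j != k -> y * entry (free_eval u h) k j = 0.
  move=> jk; have := Ev p j.
  by rewrite !hp eqxx (negbTE jk) add0r subr0.
have yu : y * entry (free_eval u h) k l = 0.
  (* Column [k] has the extra term [(u_pp + y u_kp) y]; it vanishes by the hypothesis on row [p] and
     by the case of column [p]. *)
  have [->|] := eqVneq l k; last exact: yu0.
  have := Ev p k; rewrite !hp !eqxx !add0r (yu0 p) // mul0r subr0.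
  exact: esym.
by rewrite (grass_supercomm (entry_part _ _ _) yp) yu scaler0.
Qed.

Lemma offdiag_zero (v : nat -> M) i j : ~ poly_identity M f -> i != j ->
  entry (free_eval v g) i j = 0.
Proof.
move=> nf ij; apply/eqP/negPn/negP => gij.
have col (u : nat -> M) k : k != j -> entry (free_eval u f) k i = 0.
  move=> kj; have [N] := grass_shift_regular (entry (free_eval u f) k i) gij; apply.
  (* As [k != j], the [(k, j)] entry of the central product vanishes, whatever signs twist the
     second factor. *)
  have E (s : pred 'I_n) : \sum_l entry (free_eval u f) k l *
      ((-1) ^+ (s l (+) s j) *: grass_shift N (entry (free_eval v g) l j)) = 0.
    have /super_centralP[/(_ k j kj) kj0 _] := fg_central u (super_twist N s \o v).
    by rewrite -[RHS]kj0 -free_eval_endo entryM; apply: eq_bigr => l _; rewrite super_twistE.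
  (* The two instances differ only in the sign of the term l = i. *)
  have /eqP := E (pred1 i); rewrite -[X in _ == X](E pred0) -subr_eq0 -sumrB.
  rewrite (bigD1 i) //= big1 => [|l /negbTE li].
    rewrite addr0 eqxx [j == i]eq_sym (negbTE ij) /= scale1r scaleN1r mulrN -opprD.
    rewrite oppr_eq0 -mulr2n -scaler_nat scaler_eq0 (negbTE two_neq0) => /eqP.
    exact.
  by rewrite li [j == i]eq_sym (negbTE ij) subrr.
apply/nf/(row_zero_identity (p := i)) => u k.
have [->|ki] := eqVneq k i; first exact: col.
(* Conjugation by [1 + y e_ki] changes the [(i, i)] entry by [- f(u)_ik y]. Both [(i, i)] entries
   vanish by [col], since [i != j]. *)
have [y yp yreg] := grass_part_regular (parity k i) (entry (free_eval u f) i k).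
have [w Ew] := conj_value f u yp ki.
apply: yreg; have := Ew i i; rewrite !(col _ i) // eqxx [i == k]eq_sym.
rewrite (negbTE ki) !addr0 add0r.
by move=> /esym/eqP; rewrite oppr_eq0 => /eqP.
Qed.

(** Conjugating a diagonal value by [1 + y e_ij] produces the [(i, j)] entry [y g_jj - g_ii y],
    which must vanish because the conjugate is again a value, hence diagonal. *)
Lemma central_right (v : nat -> M) z : ~ poly_identity M f -> GRing.comm (free_eval v g) z.
Proof.
move=> nf; move: z; apply/super_centralP.
split=> [i j|i j]; first exact: offdiag_zero.
have [->//|ij] := eqVneq i j; apply/eqP; rewrite eq_sym -subr_eq0; apply/eqP.
have [y yp yreg] :=
  grass_part_regular (parity i j) (entry (free_eval v g) j j - entry (free_eval v g) i i).
have [w Ew] := conj_value g v yp ij.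
have ji : j != i by rewrite eq_sym.
apply: yreg; have := Ew i j; rewrite !eqxx !(offdiag_zero _ nf ij) (offdiag_zero _ nf ji).
by rewrite mulr0 addr0 add0r mulrBl !(grass_evenC _ (entry_even _ _)) => <-.
Qed.

Lemma central_left (u : nat -> M) z : ~ poly_identity M f -> ~ poly_identity M g ->
  GRing.comm (free_eval u f) z.
Proof.
move=> nf ng; apply/eqP; rewrite -subr_eq0; apply/negPn/negP => d0; apply: ng => v.
set d := _ - _ in d0.
(* The value of [g] is central, so [d] times it is the commutator of the central product with
   [z]. *)
have dg (w : nat -> M) : d * free_eval w g = 0.
  have gC x : GRing.comm (free_eval w g) x by exact: central_right.
  have fgC := fg_central u w z.
  by rewrite mulrBl -mulrA -gC mulrA fgC -!mulrA subrr.
have [i [j dij]] : exists i j, entry d i j != 0.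
  case: (pickP (fun x : 'I_n * 'I_n => entry d x.1 x.2 != 0)) => [[i j] dij|d_0].
    by exists i, j.
  case/eqP: d0; apply/eq_entry => i j; rewrite entry0.
  by have /negbT/negPn/eqP := d_0 (i, j).
have /super_centralP[off diag] : forall x, GRing.comm (free_eval v g) x.
  by move=> x; exact: central_right.
apply/eq_entry => k l; rewrite entry0.
have [<-|] := eqVneq k l; last exact: off.
(* The nonzero scalar is read at position [j], where its shift multiplies [d_ij] in the [(i, j)]
   entry of the product. *)
rewrite (diag k j); apply/eqP/negPn/negP => gj.
have [N dN] := grass_shift_regular (entry d i j) gj; case/eqP: dij; apply: dN.
have /eq_entry/(_ i j) := dg (super_twist N pred0 \o v).
rewrite -free_eval_endo entry0 entryM (bigD1 j) //= super_twistE scale1r.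
by rewrite big1 ?addr0 // => m mj; rewrite super_twistE off // raddf0 scaler0 mulr0.
Qed.

End CentralProduct.

End SuperMatrixTheory.

Theorem theorem5p8 (F : fieldType)
  (F_infinite : forall s : seq F, exists x : F, x \notin s)
  (F_char : 2%N \notin [pchar F]%R) (a b : nat) :
  primeness_central (supermx F a b).
Proof.
move=> r s f g le_rs f_r g_s [nfg fgC].
have two_neq0 : 2%:R != 0 :> F by move: F_char; rewrite inE.
have fg_central (u v : nat -> supermx F a b) z :
    GRing.comm (free_eval u f * free_eval v g) z.
  (* The variable ranges are disjoint, so the two assignments glue into one. *)
  pose w i := if (i < r)%N then u i else v i.
  rewrite (eq_in_free_eval (w := w) f_r) => [|i /andP[_ ir]]; last by rewrite /w ir.
  rewrite (eq_in_free_eval (v := v) (w := w) g_s) => [|i /andP[ri _]]; last first.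
    by rewrite /w ltnNge ri.
  by rewrite -free_evalM; exact: fgC.
have nf : ~ poly_identity (supermx F a b) f.
  by move=> f0; apply: nfg => v; rewrite free_evalM f0 mul0r.
have ng : ~ poly_identity (supermx F a b) g.
  by move=> g0; apply: nfg => v; rewrite free_evalM g0 mulr0.
split; split=> [|v z].
- exact: nf.
- exact: (central_left two_neq0 fg_central).
- exact: ng.
- exact: (central_right two_neq0 fg_central).
Qed.
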